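(* (i) Let $\mathcal{G}$ be a semigroupal category with associativity constraint $\phi$. Then the assignment $A\mapsto(A,\phi_{A,-,-})$ defines a semigroupal functor $\mathcal{G}\to\mathcal{N}_l(\mathcal{G})$ whose composition $\mathcal{G}\to\mathcal{N}_l(\mathcal{G})\to\mathcal{G}$ with the forgetful functor is the identity. (ii) Conversely, let $\mathcal{G}$ be a magmoidal category. A functor $S:\mathcal{G}\to\mathcal{N}_l(\mathcal{G})$ whose composition $\mathcal{G}\to\mathcal{N}_l(\mathcal{G})\to\mathcal{G}$ with the forgetful functor is the identity defines an associativity constraint on $\mathcal{G}$, thus turning it into a semigroupal category: writing $S(A)=(A,a)$, the constraint is $\phi_{A,X,Y}=a_{X,Y}$.
   Context: A magmoidal category is a category $\mathcal{G}$ with a functor $\otimes:\mathcal{G}\times\mathcal{G}\to\mathcal{G}$, with no associativity or unit condition. A semigroupal category is a magmoidal category with a natural isomorphism (associativity constraint) $\phi_{X,Y,Z}:X\otimes(Y\otimes Z)\to(X\otimes Y)\otimes Z$ satisfying the pentagon axiom $\phi_{X\otimes Y,Z,W}\circ\phi_{X,Y,Z\otimes W}=(\phi_{X,Y,Z}\otimes W)\circ\phi_{X,Y\otimes Z,W}\circ(X\otimes\phi_{Y,Z,W})$. An object's name also denotes its identity morphism. A semigroupal functor $F:(\mathcal{C},\phi)\to(\mathcal{D},\psi)$ is a functor with natural isomorphisms $F_{X,Y}:F(X\otimes Y)\to F(X)\otimes F(Y)$ satisfying $\psi_{F(X),F(Y),F(Z)}\circ(F(X)\otimes F_{Y,Z})\circ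 F_{X,Y\otimes Z}=(F_{X,Y}\otimes F(Z))\circ F_{X\otimes Y,Z}\circ F(\phi_{X,Y,Z})$. The left nucleus $\mathcal{N}_l(\mathcal{G})$ of a magmoidal category has as objects pairs $(A,a)$, with $A\in\mathcal{G}$ and $a$ a family of isomorphisms $a_{X,Y}:A\otimes(X\otimes Y)\to(A\otimes X)\otimes Y$ natural in $X,Y\in\mathcal{G}$. A morphism $(A,a)\to(B,b)$ is a morphism $f:A\to B$ of $\mathcal{G}$ such that $((f\otimes X)\otimes Y)\circ a_{X,Y}=b_{X,Y}\circ(f\otimes(X\otimes Y))$ for all $X,Y$. The forgetful functor sends $(A,a)$ to $A$ and is the identity on underlying morphisms. $\mathcal{N}_l(\mathcal{G})$ is semigroupal with $(A,a)\otimes(B,b)=(A\otimes B,a|b)$, where $(a|b)_{X,Y}\circ a_{B,X\otimes Y}=(a_{B,X}\otimes Y)\circ a_{B\otimes X,Y}\circ(A\otimes b_{X,Y})$, with the tensor product of morphisms taken in $\mathcal{G}$, and with associativity constraint $\phi_{(A,a),(B,b),(C,c)}=a_{B,C}$.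
   Formalization: In (ii), a bare functor S is shown only to give a unique natural isomorphism φ with S(A)=(A,φ_A); the pentagon, which can fail for bare S, is proved when S also carries natural isomorphisms S(X⊗Y)→S(X)⊗S(Y), with no coherence required. *)

(* Defs.v *)
From Corelib Require Import ssreflect.
From Stdlib Require Import ClassicalEpsilon.

Set Implicit Arguments.
Unset Strict Implicit.
Unset Printing Implicit Defensive.

Local Obligation Tactic := idtac.

Declare Scope cat_scope.
Delimit Scope cat_scope with cat.
Local Open Scope cat_scope.

Record category := Category {
  obj :> Type;
  hom : obj -> obj -> Type;
  idm : forall X, hom X X;
  comp : forall X Y Z, hom Y Z -> hom X Y -> hom X Z;
  comp_idl : forall X Y (f : hom X Y), comp (idm Y) f = f;
  comp_idr : forall X Y (f : hom X Y), comp f (idm X) = f;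
  comp_assoc : forall X Y Z W (h : hom Z W) (g : hom Y Z) (f : hom X Y),
    comp h (comp g f) = comp (comp h g) f
}.
Arguments hom {c} _ _.
Arguments idm {c} X.
Arguments comp {c X Y Z} _ _.

Notation "g ∘ f" := (comp g f) (at level 40, left associativity) : cat_scope.

Definition is_iso (C : category) (X Y : C) (f : hom X Y) : Prop :=
  exists g : hom Y X, g ∘ f = idm X /\ f ∘ g = idm Y.

Definition inv (C : category) (X Y : C) (f : hom X Y) (fI : is_iso f) : hom Y X :=
  proj1_sig (constructive_indefinite_description _ fI).

Record functor (C D : category) := Functor {
  fobj :> C -> D;
  fmap : forall X Y : C, hom X Y -> hom (fobj X) (fobj Y);
  fmap_id : forall X : C, fmap (idm X) = idm (fobj X);
  fmap_comp : forall (X Y Z : C) (g : hom Y Z) (f : hom X Y),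
    fmap (g ∘ f) = fmap g ∘ fmap f
}.
Arguments fmap {C D} _ {X Y} _.

Definition id_functor (C : category) : functor C C :=
  @Functor C C (fun X => X) (fun X Y f => f)
    (fun X => eq_refl) (fun X Y Z g f => eq_refl).

Program Definition comp_functor (C D E : category)
    (F : functor D E) (G : functor C D) : functor C E :=
  @Functor C E (fun X => F (G X)) (fun X Y f => fmap F (fmap G f)) _ _.
Next Obligation. by move=> C D E F G X /=; rewrite !fmap_id. Qed.
Next Obligation. by move=> C D E F G X Y Z g f /=; rewrite !fmap_comp. Qed.

Program Definition product_category (C D : category) : category :=
  @Category (C * D)%type
    (fun X Y => (hom (fst X) (fst Y) * hom (snd X) (snd Y))%type)
    (fun X => (idm (fst X), idm (snd X)))
    (fun X Y Z g f => (fst g ∘ fst f, snd g ∘ snd f)) _ _ _.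
Next Obligation. by move=> C D [X X'] [Y Y'] [f f'] /=; rewrite !comp_idl. Qed.
Next Obligation. by move=> C D [X X'] [Y Y'] [f f'] /=; rewrite !comp_idr. Qed.
Next Obligation. by move=> *; rewrite /= !comp_assoc. Qed.

Record magmoidal_category := MagmoidalCategory {
  magmoidal_base :> category;
  tensor : functor (product_category magmoidal_base magmoidal_base) magmoidal_base
}.

Definition tensor_obj (G : magmoidal_category) (X Y : G) : G := tensor G (X, Y).
Notation "X ⊗ Y" := (tensor_obj X Y) (at level 35, no associativity) : cat_scope.

Definition tensor_hom (G : magmoidal_category) (X X' Y Y' : G)
    (f : hom X X') (g : hom Y Y') : hom (X ⊗ Y) (X' ⊗ Y') :=
  @fmap _ _ (tensor G) (X, Y) (X', Y') (f, g).
Notation "f ⊠ g" := (tensor_hom f g) (at level 35, no associativity) : cat_scope.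

(* A natural isomorphism X ⊗ (Y ⊗ Z) -> (X ⊗ Y) ⊗ Z, without the pentagon axiom. *)
Record associator (G : magmoidal_category) := Associator {
  assoc_mor :> forall X Y Z : G, hom (X ⊗ (Y ⊗ Z)) ((X ⊗ Y) ⊗ Z);
  assoc_natural : forall (X X' Y Y' Z Z' : G)
      (f : hom X X') (g : hom Y Y') (h : hom Z Z'),
    assoc_mor X' Y' Z' ∘ (f ⊠ (g ⊠ h)) = ((f ⊠ g) ⊠ h) ∘ assoc_mor X Y Z;
  assoc_iso : forall X Y Z : G, is_iso (assoc_mor X Y Z)
}.

Definition pentagon (G : magmoidal_category) (phi : associator G) : Prop :=
  forall X Y Z W : G,
    phi (X ⊗ Y) Z W ∘ phi X Y (Z ⊗ W) =
    (phi X Y Z ⊠ idm W) ∘ phi X (Y ⊗ Z) W ∘ (idm X ⊠ phi Y Z W).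

Record semigroupal_category := SemigroupalCategory {
  semigroupal_base :> magmoidal_category;
  constraint : associator semigroupal_base;
  constraint_pentagon : pentagon constraint
}.
Arguments constraint : clear implicits.

(* A functor F together with a natural isomorphism F (X ⊗ Y) -> F X ⊗ F Y,
   subject to no coherence condition. *)
Record magmoidal_functor (C D : magmoidal_category) := MagmoidalFunctor {
  magmoidal_fun :> functor C D;
  mult : forall X Y : C,
    hom (magmoidal_fun (X ⊗ Y)) (magmoidal_fun X ⊗ magmoidal_fun Y);
  mult_natural : forall (X X' Y Y' : C) (f : hom X X') (g : hom Y Y'),
    mult X' Y' ∘ fmap magmoidal_fun (f ⊠ g) =
    (fmap magmoidal_fun f ⊠ fmap magmoidal_fun g) ∘ mult X Y;
  mult_iso : forall X Y : C, is_iso (mult X Y)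
}.
Arguments mult {C D} _ X Y.

Record semigroupal_functor (C D : semigroupal_category) := SemigroupalFunctor {
  semigroupal_fun :> magmoidal_functor C D;
  semigroupal_coherence : forall X Y Z : C,
    constraint D (semigroupal_fun X) (semigroupal_fun Y) (semigroupal_fun Z)
      ∘ (idm (semigroupal_fun X) ⊠ mult semigroupal_fun Y Z)
      ∘ mult semigroupal_fun X (Y ⊗ Z) =
    (mult semigroupal_fun X Y ⊠ idm (semigroupal_fun Z))
      ∘ mult semigroupal_fun (X ⊗ Y) Z
      ∘ fmap semigroupal_fun (constraint C X Y Z)
}.

Section CategoryFacts.
Context {C : category}.

Lemma inv_l (X Y : C) (f : hom X Y) (fI : is_iso f) : inv fI ∘ f = idm X.
Proof. by case: (proj2_sig (constructive_indefinite_description _ fI)). Qed.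

Lemma inv_r (X Y : C) (f : hom X Y) (fI : is_iso f) : f ∘ inv fI = idm Y.
Proof. by case: (proj2_sig (constructive_indefinite_description _ fI)). Qed.

Lemma is_iso_idm (X : C) : is_iso (idm X).
Proof. by exists (idm X); rewrite comp_idl. Qed.

Lemma is_iso_inv (X Y : C) (f : hom X Y) (fI : is_iso f) : is_iso (inv fI).
Proof. by exists f; rewrite inv_l inv_r. Qed.

Lemma is_iso_comp (X Y Z : C) (g : hom Y Z) (f : hom X Y) :
  is_iso g -> is_iso f -> is_iso (g ∘ f).
Proof.
move=> [g' [g'g gg']] [f' [f'f ff']]; exists (f' ∘ g'); split.
- by rewrite comp_assoc -(comp_assoc f') g'g comp_idr.
- by rewrite comp_assoc -(comp_assoc g) ff' comp_idr.
Qed.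

Lemma iso_epi (X Y Z : C) (f : hom X Y) (g h : hom Y Z) :
  is_iso f -> g ∘ f = h ∘ f -> g = h.
Proof.
move=> [f' [_ ff']] gh.
by rewrite -(comp_idr g) -(comp_idr h) -ff' !comp_assoc gh.
Qed.

Lemma comp_square (X Y Y' Z W : C) (h : hom Z W)
    (p : hom Y Z) (q : hom X Y) (r : hom Y' Z) (s : hom X Y') :
  p ∘ q = r ∘ s -> h ∘ p ∘ q = h ∘ r ∘ s.
Proof. by rewrite -!comp_assoc => ->. Qed.

Lemma is_iso_fmap (D : category) (F : functor C D) (X Y : C) (f : hom X Y) :
  is_iso f -> is_iso (fmap F f).
Proof.
by move=> [g [gf fg]]; exists (fmap F g); rewrite -!fmap_comp gf fg !fmap_id.
Qed.

End CategoryFacts.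

Section TensorFacts.
Context {G : magmoidal_category}.

Lemma tensor_id (X Y : G) : idm X ⊠ idm Y = idm (X ⊗ Y).
Proof. exact: (fmap_id (tensor G) (X, Y)). Qed.

Lemma tensor_comp (X X' X'' Y Y' Y'' : G) (f' : hom X' X'') (f : hom X X')
    (g' : hom Y' Y'') (g : hom Y Y') :
  (f' ⊠ g') ∘ (f ⊠ g) = (f' ∘ f) ⊠ (g' ∘ g).
Proof.
exact: (eq_sym (@fmap_comp _ _ (tensor G) (X, Y) (X', Y') (X'', Y'') (f', g') (f, g))).
Qed.

Lemma comp_whiskerl (A X Y Z : G) (g : hom Y Z) (f : hom X Y) :
  idm A ⊠ (g ∘ f) = (idm A ⊠ g) ∘ (idm A ⊠ f).
Proof. by rewrite tensor_comp comp_idl. Qed.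

Lemma comp_whiskerr (A X Y Z : G) (g : hom Y Z) (f : hom X Y) :
  (g ∘ f) ⊠ idm A = (g ⊠ idm A) ∘ (f ⊠ idm A).
Proof. by rewrite tensor_comp comp_idl. Qed.

Lemma is_iso_tensor (X X' Y Y' : G) (f : hom X X') (g : hom Y Y') :
  is_iso f -> is_iso g -> is_iso (f ⊠ g).
Proof.
move=> [f' [f'f ff']] [g' [g'g gg']]; exists (f' ⊠ g').
by rewrite !tensor_comp f'f ff' g'g gg' !tensor_id.
Qed.

End TensorFacts.

Program Definition id_magmoidal_functor (C : magmoidal_category) :
    magmoidal_functor C C :=
  @MagmoidalFunctor C C (id_functor C) (fun X Y => idm (X ⊗ Y)) _ _.
Next Obligation. by move=> *; rewrite /= comp_idl comp_idr. Qed.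
Next Obligation. by move=> *; apply: is_iso_idm. Qed.

Program Definition comp_magmoidal_functor (C D E : magmoidal_category)
    (F : magmoidal_functor D E) (G : magmoidal_functor C D) :
    magmoidal_functor C E :=
  @MagmoidalFunctor C E (comp_functor F G)
    (fun X Y => mult F (G X) (G Y) ∘ fmap F (mult G X Y)) _ _.
Next Obligation.
move=> C D E F G X X' Y Y' f g /=.
rewrite -comp_assoc -fmap_comp mult_natural fmap_comp !comp_assoc.
by rewrite mult_natural.
Qed.
Next Obligation.
by move=> *; apply: is_iso_comp; [|apply: is_iso_fmap]; apply: mult_iso.
Qed.

Section LeftNucleus.
Context (G : magmoidal_category).

Record ln_obj := LnObj {
  ln_carrier :> G;
  ln_mor : forall X Y : G,
    hom (ln_carrier ⊗ (X ⊗ Y)) ((ln_carrier ⊗ X) ⊗ Y);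
  ln_natural : forall (X X' Y Y' : G) (f : hom X X') (g : hom Y Y'),
    ln_mor X' Y' ∘ (idm ln_carrier ⊠ (f ⊠ g)) =
    ((idm ln_carrier ⊠ f) ⊠ g) ∘ ln_mor X Y;
  ln_iso : forall X Y : G, is_iso (ln_mor X Y)
}.

Record ln_hom (A B : ln_obj) := LnHom {
  ln_fun :> hom (ln_carrier A) (ln_carrier B);
  ln_funP : forall X Y : G,
    ((ln_fun ⊠ idm X) ⊠ idm Y) ∘ ln_mor A X Y =
    ln_mor B X Y ∘ (ln_fun ⊠ idm (X ⊗ Y))
}.

Lemma ln_hom_eq (A B : ln_obj) (f g : ln_hom A B) :
  ln_fun f = ln_fun g -> f = g.
Proof.
case: f g => [f fP] [g gP] /= fg; case: g / fg gP => gP.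
by rewrite (proof_irrelevance _ fP gP).
Qed.

Program Definition ln_idm (A : ln_obj) : ln_hom A A := @LnHom A A (idm A) _.
Next Obligation. by move=> *; rewrite !tensor_id comp_idl comp_idr. Qed.

Program Definition ln_comp (A B C : ln_obj) (g : ln_hom B C) (f : ln_hom A B) :
  ln_hom A C := @LnHom A C (ln_fun g ∘ ln_fun f) _.
Next Obligation.
move=> A B C g f X Y.
have h1 Z W : (ln_fun g ∘ ln_fun f) ⊠ idm (Z ⊗ W) =
    (ln_fun g ⊠ idm (Z ⊗ W)) ∘ (ln_fun f ⊠ idm (Z ⊗ W)).
  by rewrite tensor_comp comp_idl.
have -> : ((ln_fun g ∘ ln_fun f) ⊠ idm X) ⊠ idm Y =
    ((ln_fun g ⊠ idm X) ⊠ idm Y) ∘ ((ln_fun f ⊠ idm X) ⊠ idm Y).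
  by rewrite !tensor_comp !comp_idl.
by rewrite h1 comp_assoc -ln_funP -!comp_assoc ln_funP.
Qed.

Program Definition ln_category : category :=
  @Category ln_obj ln_hom ln_idm ln_comp _ _ _.
Next Obligation. by move=> *; apply: ln_hom_eq; rewrite /= comp_idl. Qed.
Next Obligation. by move=> *; apply: ln_hom_eq; rewrite /= comp_idr. Qed.
Next Obligation. by move=> *; apply: ln_hom_eq; rewrite /= comp_assoc. Qed.

(* The morphism condition of the nucleus, combined with naturality. *)
Lemma ln_square (A A' : ln_obj) (f : ln_hom A A') (X X' Y Y' : G)
    (g : hom X X') (h : hom Y Y') :
  ln_mor A' X' Y' ∘ (ln_fun f ⊠ (g ⊠ h)) =
  ((ln_fun f ⊠ g) ⊠ h) ∘ ln_mor A X Y.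
Proof.
have -> : ln_fun f ⊠ (g ⊠ h) =
    (ln_fun f ⊠ idm (X' ⊗ Y')) ∘ (idm A ⊠ (g ⊠ h)).
  by rewrite tensor_comp comp_idl comp_idr.
rewrite comp_assoc -ln_funP -comp_assoc ln_natural comp_assoc.
by rewrite !tensor_comp !comp_idl !comp_idr.
Qed.

(* The family a|b, determined by ln_barE below. *)
Definition ln_bar (A B : ln_obj) (X Y : G) :
    hom ((A ⊗ B) ⊗ (X ⊗ Y)) (((A ⊗ B) ⊗ X) ⊗ Y) :=
  (ln_mor A B X ⊠ idm Y) ∘ ln_mor A (B ⊗ X) Y ∘ (idm A ⊠ ln_mor B X Y)
    ∘ inv (ln_iso A B (X ⊗ Y)).

Lemma ln_barE (A B : ln_obj) (X Y : G) :
  ln_bar A B X Y ∘ ln_mor A B (X ⊗ Y) =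
  (ln_mor A B X ⊠ idm Y) ∘ ln_mor A (B ⊗ X) Y ∘ (idm A ⊠ ln_mor B X Y).
Proof. by rewrite /ln_bar -comp_assoc inv_l comp_idr. Qed.

Lemma ln_bar_square (A A' B B' : ln_obj) (f : ln_hom A A') (g : ln_hom B B')
    (X X' Y Y' : G) (h : hom X X') (k : hom Y Y') :
  ln_bar A' B' X' Y' ∘ ((ln_fun f ⊠ ln_fun g) ⊠ (h ⊠ k)) =
  (((ln_fun f ⊠ ln_fun g) ⊠ h) ⊠ k) ∘ ln_bar A B X Y.
Proof.
apply: (iso_epi (ln_iso A B (X ⊗ Y))).
rewrite -(comp_assoc _ (ln_bar A B X Y)) ln_barE.
rewrite -comp_assoc -ln_square !comp_assoc ln_barE.
rewrite -(comp_assoc _ (idm A' ⊠ _)) tensor_comp comp_idl ln_square.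
rewrite -(comp_idr (ln_fun f)) -tensor_comp !comp_assoc comp_idr.
rewrite (comp_square _ (ln_square f _ k)) !tensor_comp.
by rewrite ln_square comp_idl comp_idr.
Qed.

Program Definition ln_tensor_obj (A B : ln_obj) : ln_obj :=
  @LnObj (A ⊗ B) (ln_bar A B) _ _.
Next Obligation.
move=> A B X X' Y Y' f g.
by have := ln_bar_square (ln_idm A) (ln_idm B) f g; rewrite /= tensor_id.
Qed.
Next Obligation.
move=> A B X Y; rewrite /ln_bar.
do !apply: is_iso_comp; try exact: is_iso_inv; try exact: ln_iso.
- by apply: is_iso_tensor; [apply: ln_iso | apply: is_iso_idm].
- by apply: is_iso_tensor; [apply: is_iso_idm | apply: ln_iso].
Qed.

Program Definition ln_tensor_hom (A A' B B' : ln_obj)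
    (f : ln_hom A A') (g : ln_hom B B') :
    ln_hom (ln_tensor_obj A B) (ln_tensor_obj A' B') :=
  @LnHom (ln_tensor_obj A B) (ln_tensor_obj A' B') (ln_fun f ⊠ ln_fun g) _.
Next Obligation.
by move=> A A' B B' f g X Y; rewrite /= -ln_bar_square tensor_id.
Qed.

Program Definition ln_tensor :
    functor (product_category ln_category ln_category) ln_category :=
  @Functor (product_category ln_category ln_category) ln_category
    (fun A => ln_tensor_obj (fst A) (snd A))
    (fun A B f => ln_tensor_hom (fst f) (snd f)) _ _.
Next Obligation. by move=> *; apply: ln_hom_eq; rewrite /= tensor_id. Qed.
Next Obligation. by move=> *; apply: ln_hom_eq; rewrite /= tensor_comp. Qed.

Definition ln_magmoidal : magmoidal_category := MagmoidalCategory ln_tensor.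

Program Definition ln_assoc_hom (A B C : ln_obj) :
    ln_hom (ln_tensor_obj A (ln_tensor_obj B C))
           (ln_tensor_obj (ln_tensor_obj A B) C) :=
  @LnHom (ln_tensor_obj A (ln_tensor_obj B C))
    (ln_tensor_obj (ln_tensor_obj A B) C) (ln_mor A B C) _.
Next Obligation.
move=> A B C X Y /=.
apply: (iso_epi (ln_iso A (B ⊗ C) (X ⊗ Y))).
apply: (iso_epi (is_iso_tensor (is_iso_idm A) (ln_iso B C (X ⊗ Y)))).
rewrite -2!(comp_assoc (ln_bar (ln_tensor_obj A B) C X Y)).
have /= <- := ln_barE A B C (X ⊗ Y).
have /= E := ln_barE (ln_tensor_obj A B) C X Y; rewrite comp_assoc E {E}.
have /= E := ln_barE A (ln_tensor_obj B C) X Y.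
rewrite -(comp_assoc _ (ln_bar A (ln_tensor_obj B C) X Y)) E {E}.
have := ln_natural A (idm B) (ln_mor C X Y); rewrite tensor_id => E.
rewrite -(comp_assoc _ (_ ⊠ _) (ln_mor A B _)) -E {E}.
rewrite (comp_assoc _ (ln_mor A B ((C ⊗ X) ⊗ Y))).
rewrite -(comp_assoc _ (ln_bar A B _ _)) ln_barE !comp_assoc tensor_comp.
rewrite comp_idl ln_barE.
rewrite -(comp_assoc _ (idm A ⊠ ln_bar B C X Y)) tensor_comp comp_idl ln_barE.
rewrite !comp_whiskerl !comp_whiskerr !comp_assoc.
by rewrite (comp_square _ (ln_natural A (ln_mor B C X) (idm Y))).
Qed.

Program Definition ln_associator : associator ln_magmoidal :=
  @Associator ln_magmoidal ln_assoc_hom _ _.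
Next Obligation.
by move=> X X' Y Y' Z Z' f g h; apply: ln_hom_eq; exact: ln_square.
Qed.
Next Obligation.
move=> A B C; pose i := ln_iso A B C.
have iP X Y : ((inv i ⊠ idm X) ⊠ idm Y)
    ∘ ln_mor (ln_tensor_obj (ln_tensor_obj A B) C) X Y =
  ln_mor (ln_tensor_obj A (ln_tensor_obj B C)) X Y ∘ (inv i ⊠ idm (X ⊗ Y)).
  have iI := is_iso_tensor i (is_iso_idm (X ⊗ Y)).
  apply: (iso_epi iI); have /= E := ln_funP (ln_assoc_hom A B C) X Y.
  rewrite -comp_assoc -[in LHS]E comp_assoc !tensor_comp -comp_assoc tensor_comp.
  by rewrite inv_l !comp_idl !tensor_id comp_idl comp_idr.
exists (@LnHom (ln_tensor_obj (ln_tensor_obj A B) C)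
               (ln_tensor_obj A (ln_tensor_obj B C)) (inv i) iP).
by split; apply: ln_hom_eq; rewrite /= ?inv_l ?inv_r.
Qed.

Lemma ln_pentagon : pentagon ln_associator.
Proof. by move=> A B C D; apply: ln_hom_eq; exact: ln_barE. Qed.

Definition left_nucleus : semigroupal_category := SemigroupalCategory ln_pentagon.

Definition forget_functor : functor left_nucleus G :=
  @Functor left_nucleus G ln_carrier ln_fun
    (fun A => eq_refl) (fun A B C g f => eq_refl).

(* The tensor product is strictly preserved. *)
Program Definition forget : magmoidal_functor left_nucleus G :=
  @MagmoidalFunctor left_nucleus G forget_functor
    (fun A B => idm (ln_carrier A ⊗ ln_carrier B)) _ _.
Next Obligation. by move=> *; rewrite comp_idl comp_idr. Qed.
Next Obligation. by move=> *; apply: is_iso_idm. Qed.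

(* The pair (A, phi_{A,-,-}). *)
Program Definition associator_ln_obj (phi : associator G) (A : G) : left_nucleus :=
  @LnObj A (phi A) _ _.
Next Obligation. by move=> *; apply: assoc_natural. Qed.
Next Obligation. by move=> *; apply: assoc_iso. Qed.

End LeftNucleus.

(* Main.v *)
(** If [S : G -> N_l(G)] is a section of the forgetful functor, functoriality of
    [S] says exactly that the components [a_{X,Y}] of [S A = (A, a)] are natural
    in [A] as well, so they form an associator [phi]. The pentagon says that
    [phi_{A ⊗ B} = phi_A | phi_B], i.e. that the identity of [A ⊗ B] is a morphism
    [S (A ⊗ B) -> S A ⊗ S B] of the nucleus. If some isomorphism [m] of [A ⊗ B] is
    such a morphism, then so is the identity, because by naturality [m] is also an
    automorphism of [S (A ⊗ B)] and can be cancelled. *)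

Require Import Defs.
From Corelib Require Import ssreflect.
From Stdlib Require Import ClassicalEpsilon FunctionalExtensionality Eqdep.

Set Implicit Arguments.
Unset Strict Implicit.
Unset Printing Implicit Defensive.

Local Obligation Tactic := idtac.
Local Open Scope cat_scope.

Lemma associator_eq (G : magmoidal_category) (phi psi : associator G) :
  (forall X Y Z, phi X Y Z = psi X Y Z) -> phi = psi.
Proof.
case: phi psi => [phi phiN phiI] [psi psiN psiI] /= E.
have {}E : phi = psi.
  by do 3 (apply: functional_extensionality_dep => ?); exact: E.
case: psi / E psiN psiI => psiN psiI.
by rewrite (proof_irrelevance _ phiN psiN) (proof_irrelevance _ phiI psiI).
Qed.

(** Both sides share [fo] and [fm], so [m] and [m'] have the same type and can be compared without
    transport. *)
Lemma magmoidal_functor_eq (C D : magmoidal_category) (fo : C -> D)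
    (fm : forall X Y : C, hom X Y -> hom (fo X) (fo Y)) i i' c c'
    (m m' : forall X Y : C, hom (fo (X ⊗ Y)) (fo X ⊗ fo Y)) n n' u u' :
  (forall X Y, m X Y = m' X Y) ->
  @MagmoidalFunctor C D (@Functor C D fo fm i c) m n u =
  @MagmoidalFunctor C D (@Functor C D fo fm i' c') m' n' u'.
Proof.
move=> E; have {}E : m = m'.
  by do 2 (apply: functional_extensionality_dep => ?); exact: E.
case: m' / E n' u' => n' u'.
case: i' / (proof_irrelevance _ i i') n' u' => n' u'.
case: c' / (proof_irrelevance _ c c') n' u' => n' u'.
by rewrite (proof_irrelevance _ n n') (proof_irrelevance _ u u').
Qed.

Section LeftNucleusSections.
Context {G : magmoidal_category}.

Lemma ln_obj_eq (A : G) (a b : forall X Y : G, hom (A ⊗ (X ⊗ Y)) ((A ⊗ X) ⊗ Y))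
    an ai bn bi :
  a = b -> @LnObj G A a an ai = @LnObj G A b bn bi.
Proof.
move=> E; case: b / E bn bi => bn bi.
by rewrite (proof_irrelevance _ an bn) (proof_irrelevance _ ai bi).
Qed.

Lemma associator_ln_obj_inj (phi psi : associator G) :
  (forall A, associator_ln_obj phi A = associator_ln_obj psi A) -> phi = psi.
Proof.
move=> E; apply: associator_eq => A X Y.
pose P A := forall X Y : G, hom (A ⊗ (X ⊗ Y)) ((A ⊗ X) ⊗ Y).
(* Forgetting the proofs turns the equality of records into one of dependent pairs over the same
   [A], whose second components agree by uniqueness of identity proofs. *)
pose code (a : ln_obj G) : {A : G & P A} := existT P (ln_carrier a) (@ln_mor G a).
have /(inj_pair2 _ P) /= E' := f_equal code (E A).
by rewrite E'.
Qed.

(* Replacing the identity functor by a variable [H] lets the hypothesis be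
   eliminated, so that no transport along equalities of objects is needed. *)
Lemma ln_lift_components (T : functor G (left_nucleus G)) (H : functor G G) :
  comp_functor (forget_functor G) T = H ->
  exists a : forall A X Y : G, hom (H A ⊗ (X ⊗ Y)) ((H A ⊗ X) ⊗ Y),
    (forall (A A' X X' Y Y' : G) (f : hom A A') (g : hom X X') (h : hom Y Y'),
          a A' X' Y' ∘ (fmap H f ⊠ (g ⊠ h)) =
          ((fmap H f ⊠ g) ⊠ h) ∘ a A X Y) /\
    (forall A X Y, is_iso (a A X Y)) /\
    (forall A, exists an ai, T A = @LnObj G (H A) (a A) an ai).
Proof.
case: H / => /=; exists (fun A => @ln_mor G (T A)); split; last split.
- by move=> *; exact: ln_square.
- by move=> *; exact: ln_iso.
- by move=> A; case: (T A) => B b bn bi; exists bn, bi.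
Qed.

Lemma section_associator (T : functor G (left_nucleus G)) :
  comp_functor (forget_functor G) T = id_functor G ->
  exists phi : associator G, forall A : G, T A = associator_ln_obj phi A.
Proof.
move=> /ln_lift_components [a [aN [aI aE]]].
(* With [H] the identity functor, [fmap H f] is convertible to [f], so [aN] is naturality in all
   three variables. *)
exists (@Associator G a aN aI).
by move=> A; case: (aE A) => an [ai ->]; exact: ln_obj_eq.
Qed.

Lemma ln_bar_associator_of_iso (phi : associator G) (A B X Y : G)
    (m : @hom (left_nucleus G) (associator_ln_obj phi (A ⊗ B))
         (associator_ln_obj phi A ⊗ associator_ln_obj phi B)) :
  is_iso m ->
  ln_bar (associator_ln_obj phi A) (associator_ln_obj phi B) X Y
    = phi (A ⊗ B) X Y.
Proof.
move=> /(is_iso_fmap (forget_functor G)) /= mI.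
(* After precomposing with [m ⊠ idm (X ⊗ Y)], both sides equal
   [((m ⊠ idm X) ⊠ idm Y) ∘ phi (A ⊗ B) X Y]: the left by the morphism condition on [m], the right
   by naturality of [phi]. *)
apply: (iso_epi (is_iso_tensor mI (is_iso_idm (X ⊗ Y)))).
have /= <- := ln_funP m X Y.
by rewrite -tensor_id assoc_natural.
Qed.

(** The equation [ln_barE] has the shape of the pentagon, and it has only one solution because
    [phi A B (X ⊗ Y)] is epi. *)
Lemma pentagon_ln_bar (phi : associator G) :
  pentagon phi <->
  forall A B X Y : G,
    ln_bar (associator_ln_obj phi A) (associator_ln_obj phi B) X Y
      = phi (A ⊗ B) X Y.
Proof.
split=> [P A B X Y | E A B X Y].
- apply: (iso_epi (assoc_iso phi A B (X ⊗ Y))); rewrite P.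
  exact: (ln_barE (associator_ln_obj phi A) (associator_ln_obj phi B)).
- rewrite -E.
  exact: (ln_barE (associator_ln_obj phi A) (associator_ln_obj phi B)).
Qed.

Lemma section_pentagon (S : magmoidal_functor G (left_nucleus G))
    (phi : associator G) :
  (forall A : G, S A = associator_ln_obj phi A) -> pentagon phi.
Proof.
move=> E; apply/pentagon_ln_bar => A B X Y.
(* Generalizing over [mult S A B] allows [E] to rewrite the objects in its type. *)
have := mult_iso S A B; move: (mult S A B); rewrite !E.
exact: ln_bar_associator_of_iso.
Qed.

End LeftNucleusSections.

Section SemigroupalSection.
Context (G : semigroupal_category).
Notation phi := (constraint G).

Program Definition associator_ln_hom (A B : G) (f : hom A B) :
    @hom (left_nucleus G) (associator_ln_obj phi A) (associator_ln_obj phi B) :=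
  @LnHom G (associator_ln_obj phi A) (associator_ln_obj phi B) f _.
Next Obligation. by move=> A B f X Y; rewrite /= -tensor_id assoc_natural. Qed.

Program Definition associator_functor : functor G (left_nucleus G) :=
  @Functor G (left_nucleus G) (associator_ln_obj phi) associator_ln_hom _ _.
Next Obligation. by move=> *; exact: ln_hom_eq. Qed.
Next Obligation. by move=> *; exact: ln_hom_eq. Qed.

(** This form of the pentagon makes the identity of [A ⊗ B] a nucleus morphism in both
    directions. *)
Let bar_phi := proj1 (pentagon_ln_bar phi) (@constraint_pentagon G).

Program Definition associator_mult (A B : G) :
    @hom (left_nucleus G) (associator_ln_obj phi (A ⊗ B))
      (associator_ln_obj phi A ⊗ associator_ln_obj phi B) :=
  @LnHom G (associator_ln_obj phi (A ⊗ B))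
    (ln_tensor_obj (associator_ln_obj phi A) (associator_ln_obj phi B))
    (idm (A ⊗ B)) _.
Next Obligation.
by move=> A B X Y; rewrite /= bar_phi !tensor_id comp_idl comp_idr.
Qed.

Program Definition associator_mult_inv (A B : G) :
    @hom (left_nucleus G) (associator_ln_obj phi A ⊗ associator_ln_obj phi B)
      (associator_ln_obj phi (A ⊗ B)) :=
  @LnHom G
    (ln_tensor_obj (associator_ln_obj phi A) (associator_ln_obj phi B))
    (associator_ln_obj phi (A ⊗ B)) (idm (A ⊗ B)) _.
Next Obligation.
by move=> A B X Y; rewrite /= bar_phi !tensor_id comp_idl comp_idr.
Qed.

Program Definition associator_magmoidal_functor :
    magmoidal_functor G (left_nucleus G) :=
  @MagmoidalFunctor G (left_nucleus G) associator_functor associator_mult _ _.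
Next Obligation.
by move=> *; apply: ln_hom_eq; rewrite /= comp_idl comp_idr.
Qed.
Next Obligation.
move=> A B; exists (associator_mult_inv A B).
by split; apply: ln_hom_eq; rewrite /= comp_idl.
Qed.

Program Definition associator_semigroupal_functor :
    semigroupal_functor G (left_nucleus G) :=
  @SemigroupalFunctor G (left_nucleus G) associator_magmoidal_functor _.
Next Obligation.
(* The comparison maps are identities in [G], so both sides reduce to [phi A B C]. *)
by move=> A B C; apply: ln_hom_eq; rewrite /= !tensor_id !comp_idl !comp_idr.
Qed.

Lemma forget_associator_functor :
  comp_magmoidal_functor (forget G) associator_semigroupal_functor
    = id_magmoidal_functor G.
Proof. by apply: magmoidal_functor_eq => X Y; rewrite /= comp_idl. Qed.

End SemigroupalSection.

Theorem theorem2p1p2 :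
  (forall G : semigroupal_category,
     exists S : semigroupal_functor G (left_nucleus G),
       (forall A : G, S A = associator_ln_obj (constraint G) A) /\
       comp_magmoidal_functor (forget G) S = id_magmoidal_functor G) /\
  (forall G : magmoidal_category,
     (forall S : functor G (left_nucleus G),
        comp_functor (forget_functor G) S = id_functor G ->
        exists! phi : associator G,
          forall A : G, S A = associator_ln_obj phi A) /\
     (forall S : magmoidal_functor G (left_nucleus G),
        comp_functor (forget_functor G) S = id_functor G ->
        exists! phi : associator G,
          pentagon phi /\ forall A : G, S A = associator_ln_obj phi A)).
Proof.
split=> [G | G].
  exists (associator_semigroupal_functor G).
  by split=> //; exact: forget_associator_functor.
(* Both claims use the same [phi]; it is unique because [S] determines each pair [(A, phi A)]. *)
split=> S /section_associator [phi E]; exists phi.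
- split=> // psi E'.
  by apply: associator_ln_obj_inj => A; rewrite -E -E'.
- split; first by split=> //; exact: section_pentagon E.
  move=> psi [_ E'].
  by apply: associator_ln_obj_inj => A; rewrite -E -E'.
Qed.
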